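(* Let $k$ and $t$ be positive integers with $0<t<k-1$. Then there exist PDAs with each of the following parameters: (a) a $(t+1)$-$\left(k,\binom{k}{t},\binom{k-1}{t-1},\binom{k}{t+1}\right)$ PDA with $t$ stars in each row; (b) a $\left(k,\binom{k}{t+1},\binom{k-1}{t+1},\binom{k}{t}\right)$ PDA; (c) a $\left(\binom{k}{t+1},\binom{k}{t},\binom{k}{t}-(t+1),k\right)$ PDA; (d) a $\left(\binom{k}{t+1},k,k-(t+1),\binom{k}{t}\right)$ PDA; (e) a $\left(\binom{k}{t},\binom{k}{t+1},\binom{k}{t+1}-(k-t),k\right)$ PDA; (f) a $\left(\binom{k}{t},k,t,\binom{k}{t+1}\right)$ PDA.
   Context: Write $[0,b)=\{0,1,\ldots,b-1\}$. For positive integers $K,F$, a $(K,F,S)$ placement delivery array (PDA) is an $F\times K$ array $\mathbf{P}=(p_{i,j})$, $i\in[0,F)$, $j\in[0,K)$, each of whose entries is either the symbol $*$ (''star'') or an integer from $[0,S)$, such that: whenever two distinct entries satisfy $p_{i_1,j_1}=p_{i_2,j_2}=s$ with $s$ an integer, then (a) $i_1\neq i_2$ and $j_1\neq j_2$, and (b) $p_{i_1,j_2}=p_{i_2,j_1}=*$. A $(K,F,Z,S)$ PDA is a $(K,F,S)$ PDA in which each column has exactly $Z$ stars. It is $g$-regular, written $g$-$(K,F,Z,S)$ PDA, if each integer of $[0,S)$ appears exactly $g$ times in the array. *)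

(* Defs.v *)
From mathcomp Require Import all_boot all_algebra.

Set Implicit Arguments.
Unset Strict Implicit.
Unset Printing Implicit Defensive.

(* F x K arrays (F rows, K columns) over stars and the integers of [0, S):
   the star is None, the integer s is Some s. *)
Definition array (K F S : nat) : Type := 'M[option 'I_S]_(F, K).

(* "Distinct entries" are entries in distinct positions.  An integer of [0, S)
   is not required to occur. *)
Definition is_PDA (K F S : nat) (P : array K F S) : Prop :=
  [/\ 0 < K, 0 < F &
      forall (i1 i2 : 'I_F) (j1 j2 : 'I_K) (s : 'I_S),
        (i1, j1) <> (i2, j2) -> P i1 j1 = Some s -> P i2 j2 = Some s ->
        (i1 <> i2 /\ j1 <> j2) /\ (P i1 j2 = None /\ P i2 j1 = None)].

Definition col_stars (K F S : nat) (P : array K F S) (j : 'I_K) : nat :=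
  #|[set i : 'I_F | P i j == None]|.

Definition row_stars (K F S : nat) (P : array K F S) (i : 'I_F) : nat :=
  #|[set j : 'I_K | P i j == None]|.

Definition occurrences (K F S : nat) (P : array K F S) (s : 'I_S) : nat :=
  #|[set ij : 'I_F * 'I_K | P ij.1 ij.2 == Some s]|.

Definition is_PDA_with (K F Z S : nat) (P : array K F S) : Prop :=
  is_PDA P /\ forall j : 'I_K, col_stars P j = Z.

Definition is_regular_PDA (g K F Z S : nat) (P : array K F S) : Prop :=
  is_PDA_with Z P /\ forall s : 'I_S, occurrences P s = g.

Definition exists_PDA (K F Z S : nat) : Prop :=
  exists P : array K F S, is_PDA_with Z P.

(* Main.v *)
Require Import Defs.
From mathcomp Require Import all_boot all_algebra.

(** Regard a PDA as the ternary relation "row [u], column [v] holds integer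
    [w]".  The PDA axioms say exactly that three triples of the relation which
    pairwise share a row, a column and an integer coincide, and this condition
    is symmetric in the three coordinates.  All six arrays come from the single
    relation [B = A :|: [set x]], [x \notin A], between the t-subsets [A], the
    points [x] and the (t+1)-subsets [B] of a k-set, by permuting the roles of
    rows, columns and integers. *)

Set Implicit Arguments.
Unset Strict Implicit.
Unset Printing Implicit Defensive.

(** * Ternary relations and exchanges of their coordinates *)

(** The three triples need not be distinct: when two of them are equal, the condition says that two
    coordinates of a triple determine the third. *)
Definition triforce_free (U V W : Type) (T : U -> V -> W -> bool) : Prop :=
  forall u u' v v' w w', T u v' w -> T u' v w -> T u v w' ->
    [/\ u = u', v = v' & w = w'].

Lemma triforce_free_swap12 (U V W : Type) (T : U -> V -> W -> bool) :
  triforce_free T -> triforce_free (fun v u w => T u v w).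
Proof.
move=> tfT v v' u u' w w' T1 T2 T3.
by case: (tfT _ _ _ _ _ _ T2 T1 T3).
Qed.

Lemma triforce_free_swap23 (U V W : Type) (T : U -> V -> W -> bool) :
  triforce_free T -> triforce_free (fun u w v => T u v w).
Proof.
move=> tfT u u' w w' v v' T1 T2 T3.
by case: (tfT _ _ _ _ _ _ T3 T2 T1) => -> -> ->.
Qed.

(** * The array of a ternary relation *)

(** Rows are indexed by [U], columns by [V], integers by [W], all through [enum_val]. The choice
    made by [pick] is unambiguous once [T] is triforce-free. *)
Definition relation_array (U V W : finType) (T : U -> V -> W -> bool) :
    array #|V| #|U| #|W| :=
  (\matrix_(i, j) [pick s | T (enum_val i) (enum_val j) (enum_val s)])%R.

Lemma relation_array_None (U V W : finType) (T : U -> V -> W -> bool) i j :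
  (relation_array T i j == None) =
  ~~ [exists w, T (enum_val i) (enum_val j) w].
Proof.
rewrite mxE; case: pickP => [s Ts | noT].
  by apply/esym/negbF/existsP; exists (enum_val s).
apply/esym/existsPn => w; apply/negbT.
by rewrite -[w]enum_rankK noT.
Qed.

Lemma relation_array_Some (U V W : finType) (T : U -> V -> W -> bool) i j s :
  triforce_free T ->
  (relation_array T i j == Some s) = T (enum_val i) (enum_val j) (enum_val s).
Proof.
move=> tfT; rewrite mxE; case: pickP => [r Tr | -> //].
apply/eqP/idP => [[<-] // | Ts].
by case: (tfT _ _ _ _ _ _ Tr Tr Ts) => _ _ /enum_val_inj ->.
Qed.

Lemma relation_array_PDA (U V W : finType) (T : U -> V -> W -> bool) :
  triforce_free T -> 0 < #|U| -> 0 < #|V| -> is_PDA (relation_array T).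
Proof.
move=> tfT U_gt0 V_gt0; split=> // i1 i2 j1 j2 s ne.
move/eqP; rewrite relation_array_Some // => T1.
move/eqP; rewrite relation_array_Some // => T2.
have abs : enum_val i1 = enum_val i2 -> enum_val j1 = enum_val j2 -> False.
  by move=> /enum_val_inj eq_i /enum_val_inj eq_j; case: ne; rewrite eq_i eq_j.
split; split.
(* In a common row, the row and the integer determine the column; the next case is the same for a
   common column. *)
- move=> eq_i; rewrite -eq_i in T2.
  by case: (tfT _ _ _ _ _ _ T1 T2 T2) => _ eq_j _; apply: abs; rewrite ?eq_i.
- move=> eq_j; rewrite -eq_j in T2.
  by case: (tfT _ _ _ _ _ _ T1 T2 T1) => eq_i _ _; apply: abs; rewrite -?eq_j.
(* An integer [w] in the cell ([i1], [j2]) would complete a triforce with the two occurrences of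
   [s], so the two positions would coincide. *)
- apply/eqP; rewrite relation_array_None; apply/existsPn => w.
  apply/negP => T3.
  by case: (tfT _ _ _ _ _ _ T1 T2 T3) => eq_i /esym eq_j _; apply: abs.
- apply/eqP; rewrite relation_array_None; apply/existsPn => w.
  apply/negP => T3.
  by case: (tfT _ _ _ _ _ _ T2 T1 T3) => /esym eq_i eq_j _; apply: abs.
Qed.

Lemma card_enum_val_preim (U : finType) (p : pred U) :
  #|[set i : 'I_#|U| | p (enum_val i)]| = #|[set u | p u]|.
Proof.
rewrite -(card_imset _ enum_val_inj); apply: eq_card => u; rewrite inE.
apply/imsetP/idP => [[i] | pu]; first by rewrite inE => pi ->.
by exists (enum_rank u); rewrite ?inE enum_rankK.
Qed.

Lemma relation_array_col_stars (U V W : finType) (T : U -> V -> W -> bool) j :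
  col_stars (relation_array T) j =
  #|[set u | ~~ [exists w, T u (enum_val j) w]]|.
Proof.
rewrite -card_enum_val_preim; apply: eq_card => i.
by rewrite !inE relation_array_None.
Qed.

Lemma relation_array_row_stars (U V W : finType) (T : U -> V -> W -> bool) i :
  row_stars (relation_array T) i =
  #|[set v | ~~ [exists w, T (enum_val i) v w]]|.
Proof.
rewrite -card_enum_val_preim; apply: eq_card => j.
by rewrite !inE relation_array_None.
Qed.

(* The integer and the column determine the row, so only columns are counted. *)
Lemma relation_array_occurrences (U V W : finType) (T : U -> V -> W -> bool) s :
  triforce_free T ->
  occurrences (relation_array T) s =
  #|[set v | [exists u, T u v (enum_val s)]]|.
Proof.
move=> tfT; rewrite -card_enum_val_preim /occurrences.
rewrite -(@card_in_imset _ _ snd).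
  apply: eq_card => j; rewrite inE; apply/imsetP/existsP.
    case=> -[i j']; rewrite inE /= relation_array_Some // => Tij ->.
    by exists (enum_val i).
  case=> u Tu; exists (enum_rank u, j); rewrite // inE /=.
  by rewrite relation_array_Some // enum_rankK.
move=> [i1 j1] [i2 j2]; rewrite !inE /= !relation_array_Some // => T1 T2 eq_j.
rewrite -eq_j in T2 *.
by case: (tfT _ _ _ _ _ _ T1 T2 T1) => /enum_val_inj ->.
Qed.

Lemma triforce_free_exists_PDA (U V W : finType) (T : U -> V -> W -> bool)
    (K F Z S : nat) :
  triforce_free T -> #|V| = K -> #|U| = F -> #|W| = S -> 0 < K -> 0 < F ->
  (forall v, #|[set u | ~~ [exists w, T u v w]]| = Z) ->
  exists_PDA K F Z S.
Proof.
move=> tfT <- <- <- V_gt0 U_gt0 cardZ; exists (relation_array T).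
by split=> [|j]; [apply: relation_array_PDA | rewrite relation_array_col_stars].
Qed.

Lemma triforce_free_regular_PDA (U V W : finType) (T : U -> V -> W -> bool)
    (g K F Z Z' S : nat) :
  triforce_free T -> #|V| = K -> #|U| = F -> #|W| = S -> 0 < K -> 0 < F ->
  (forall v, #|[set u | ~~ [exists w, T u v w]]| = Z) ->
  (forall u, #|[set v | ~~ [exists w, T u v w]]| = Z') ->
  (forall w, #|[set v | [exists u, T u v w]]| = g) ->
  exists P : array K F S,
    is_regular_PDA g Z P /\ forall i, row_stars P i = Z'.
Proof.
move=> tfT <- <- <- V_gt0 U_gt0 cardZ cardZ' cardg; exists (relation_array T).
split=> [|i]; last by rewrite relation_array_row_stars.
split=> [|s]; last by rewrite relation_array_occurrences.
by split=> [|j]; [apply: relation_array_PDA | rewrite relation_array_col_stars].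
Qed.

(** * Counting subsets of fixed size *)

Definition subsets_of_card (X : finType) (n : nat) : finType :=
  {A : {set X} | #|A| == n}.

Lemma card_subsets_of_card (X : finType) n :
  #|subsets_of_card X n| = 'C(#|X|, n).
Proof. by rewrite card_sig -card_draws; apply: eq_card => A; rewrite !inE. Qed.

Lemma card_subsets_of_card_pred (X : finType) n (p : pred {set X}) :
  #|[set A : subsets_of_card X n | p (val A)]| =
  #|[set A : {set X} | p A & #|A| == n]|.
Proof.
rewrite -(card_imset _ val_inj); apply: eq_card => A; rewrite !inE.
apply/imsetP/andP => [[[B cardB]] | [pA cardA]].
  by rewrite inE /= => pB ->.
by exists (Sub A cardA); rewrite ?inE.
Qed.

Lemma card_subsets_notin (X : finType) n (x : X) :
  #|[set A : subsets_of_card X n | x \notin val A]| = 'C(#|X| - 1, n).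
Proof.
rewrite (card_subsets_of_card_pred n (fun A : {set X} => x \notin A)).
have -> : #|X| - 1 = #|~: [set x]| by rewrite cardsCs setCK cards1.
rewrite -cards_draws; apply: eq_card => A; rewrite !inE.
by rewrite subsetC sub1set inE.
Qed.

(** Complementary counting and Pascal's rule. For [n = 0] the truncated [n - 1] would give 1 instead
    of 0. *)
Lemma card_subsets_in (X : finType) n (x : X) : 0 < n ->
  #|[set A : subsets_of_card X n | x \in val A]| = 'C(#|X| - 1, n - 1).
Proof.
case: n => // n _; rewrite subSS subn0.
have cardX : #|X| = (#|X| - 1).+1.
  by rewrite subn1 prednK //; apply/card_gt0P; exists x.
rewrite cardsCs.
have -> : ~: [set A : subsets_of_card X n.+1 | x \in val A] =
          [set A : subsets_of_card X n.+1 | x \notin val A].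
  by apply/setP => A; rewrite !inE.
rewrite card_subsets_notin card_subsets_of_card.
by rewrite {1}cardX binS addKn.
Qed.

(** * Adding a point to a set *)

Definition extends_by (X : finType) (n : nat) (A : subsets_of_card X n) (x : X)
    (B : subsets_of_card X (n + 1)) : bool :=
  (x \notin val A) && (val B == x |: val A).

Lemma extends_by_setD1 (X : finType) n A x B :
  @extends_by X n A x B = (x \in val B) && (val A == val B :\ x).
Proof.
apply/andP/andP => -[xP /eqP eqAB].
  by rewrite eqAB setU11 setU1K.
by rewrite eqAB setD1K // setD11.
Qed.

(** By [T2] the point [x] lies in [B], which is [A] with [x'] added, while [T3] puts [x] outside
    [A]; hence [x = x']. Then removing or adding [x] gives [A = A'] and [B = B']. *)
Lemma extends_by_triforce_free (X : finType) n :
  triforce_free (@extends_by X n).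
Proof.
move=> A A' x x' B B' T1 T2 T3.
have eqx : x = x'.
  case/andP: T1 => _ /eqP eqB; move: T2 T3; rewrite extends_by_setD1 eqB.
  by rewrite in_setU1 => /andP[/predU1P[// | xA] _] /andP[/negP].
rewrite -{x'}eqx in T1 *; split=> //; apply: val_inj.
  by move: T1 T2; rewrite !extends_by_setD1 => /andP[_ /eqP->] /andP[_ /eqP->].
by case/andP: T1 => _ /eqP->; case/andP: T3 => _ /eqP->.
Qed.

Lemma exists_extends_by_sup (X : finType) n (A : subsets_of_card X n) x :
  [exists B, extends_by A x B] = (x \notin val A).
Proof.
apply/existsP/idP => [[B /andP[]] // | xA].
have cardB : #|x |: val A| == n + 1.
  by rewrite cardsU1 xA addnC eqn_add2r (valP A).
by exists (Sub (x |: val A) cardB); rewrite /extends_by xA /=.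
Qed.

Lemma exists_extends_by_sub (X : finType) n x
    (B : subsets_of_card X (n + 1)) :
  [exists A, extends_by A x B] = (x \in val B).
Proof.
apply/existsP/idP => [[A] | xB]; first by rewrite extends_by_setD1 => /andP[].
have cardA : #|val B :\ x| == n.
  by have := valP B; rewrite (cardsD1 x) xB addnC eqn_add2r.
by exists (Sub (val B :\ x) cardA); rewrite extends_by_setD1 xB /=.
Qed.

(** Both sides count the pairs related to [w], since each projection is injective on them. This
    replaces a count of sets by a count of points below. *)
Lemma triforce_free_card (U V W : finType) (T : U -> V -> W -> bool) w :
  triforce_free T ->
  #|[set u | [exists v, T u v w]]| = #|[set v | [exists u, T u v w]]|.
Proof.
move=> tfT; pose E := [set uv : U * V | T uv.1 uv.2 w].
have -> : [set u | [exists v, T u v w]] = fst @: E.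
  apply/setP => u; rewrite inE; apply/existsP/imsetP => [[v Tuv] | ].
    by exists (u, v); rewrite ?inE.
  by case=> -[u' v]; rewrite inE /= => Tuv ->; exists v.
have -> : [set v | [exists u, T u v w]] = snd @: E.
  apply/setP => v; rewrite inE; apply/existsP/imsetP => [[u Tuv] | ].
    by exists (u, v); rewrite ?inE.
  by case=> -[u v']; rewrite inE /= => Tuv ->; exists u.
rewrite !card_in_imset //.
  move=> [u v] [u' v']; rewrite !inE /= => T1 T2 eqv; rewrite -eqv in T2 *.
  by case: (tfT _ _ _ _ _ _ T1 T2 T1) => ->.
move=> [u v] [u' v']; rewrite !inE /= => T1 T2 equ; rewrite -equ in T2 *.
by case: (tfT _ _ _ _ _ _ T1 T2 T2) => _ ->.
Qed.

Lemma card_exists_extends_by_sub (X : finType) n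
    (B : subsets_of_card X (n + 1)) :
  #|[set A : subsets_of_card X n | [exists x, extends_by A x B]]| = n + 1.
Proof.
rewrite (triforce_free_card _ (@extends_by_triforce_free X n)).
rewrite -[RHS](eqP (valP B)); apply: eq_card => x.
by rewrite inE exists_extends_by_sub.
Qed.

Lemma card_exists_extends_by_sup (X : finType) n (A : subsets_of_card X n) :
  #|[set B | [exists x, extends_by A x B]]| = #|X| - n.
Proof.
(* The coordinates are reordered to [B], [x], [A], so that the fixed set [A] comes last. *)
have tfT := triforce_free_swap23 (triforce_free_swap12
  (triforce_free_swap23 (@extends_by_triforce_free X n))).
rewrite (triforce_free_card _ tfT).
rewrite cardsCs -[n in RHS](eqP (valP A)); congr (_ - _); apply: eq_card => x.
by rewrite !inE exists_extends_by_sup negbK.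
Qed.

Lemma card_set_predC (U : finType) (p : pred U) :
  #|[set u | ~~ p u]| = #|U| - #|[set u | p u]|.
Proof.
rewrite cardsCs; congr (_ - _); apply: eq_card => u.
by rewrite !inE negbK.
Qed.

(** * The six arrays *)

Theorem theorem8 (k t : nat) (hk : 0 < k) (ht : 0 < t) (htk : t < k - 1) :
  (* (a) *)
  (exists P : array k 'C(k, t) 'C(k, t + 1),
     is_regular_PDA (t + 1) 'C(k - 1, t - 1) P /\
     (forall i : 'I_('C(k, t)), row_stars P i = t)) /\
  (* (b) *)
  exists_PDA k 'C(k, t + 1) 'C(k - 1, t + 1) 'C(k, t) /\
  (* (c) *)
  exists_PDA 'C(k, t + 1) 'C(k, t) ('C(k, t) - (t + 1)) k /\
  (* (d) *)
  exists_PDA 'C(k, t + 1) k (k - (t + 1)) 'C(k, t) /\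
  (* (e) *)
  exists_PDA 'C(k, t) 'C(k, t + 1) ('C(k, t + 1) - (k - t)) k /\
  (* (f) *)
  exists_PDA 'C(k, t) k t 'C(k, t + 1).
Proof.
have lt1k : t + 1 < k by rewrite addnC -ltn_subRL.
have Ct_gt0 : 0 < 'C(k, t).
  by rewrite bin_gt0 (leq_trans (leq_addr 1 t) (ltnW lt1k)).
have Ct1_gt0 : 0 < 'C(k, t + 1) by rewrite bin_gt0 ltnW.
have cardk := card_ord k.
have cardt : #|subsets_of_card 'I_k t| = 'C(k, t).
  by rewrite card_subsets_of_card card_ord.
have cardt1 : #|subsets_of_card 'I_k (t + 1)| = 'C(k, t + 1).
  by rewrite card_subsets_of_card card_ord.
(* The letters after [tf] give the roles of rows, columns and integers, in this order. *)
have tfAxB := @extends_by_triforce_free 'I_k t.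
have tfxAB := triforce_free_swap12 tfAxB.
have tfABx := triforce_free_swap23 tfAxB.
have tfxBA := triforce_free_swap23 tfxAB.
have tfBAx := triforce_free_swap12 tfABx.
have tfBxA := triforce_free_swap12 tfxBA.
do ![split].
(* Row [A], column [x]: a star exactly when [x] lies in [A]. *)
- apply: (triforce_free_regular_PDA tfAxB) => // [x | A | B].
  + rewrite -[X in 'C(X - 1, _)]card_ord -(card_subsets_in x ht).
    by apply: eq_card => A; rewrite !inE exists_extends_by_sup negbK.
  + rewrite -[RHS](eqP (valP A)); apply: eq_card => x.
    by rewrite inE exists_extends_by_sup negbK.
  + rewrite -[RHS](eqP (valP B)); apply: eq_card => x.
    by rewrite inE exists_extends_by_sub.
(* Row [B], column [x]: a star exactly when [x] lies outside [B]. *)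
- apply: (triforce_free_exists_PDA tfBxA) => // x.
  rewrite -[X in 'C(X - 1, _)]card_ord -(card_subsets_notin _ x).
  by apply: eq_card => B; rewrite !inE exists_extends_by_sub.
(* The integers in column [B] sit in the [t + 1] rows obtained by removing one point of [B]. *)
- apply: (triforce_free_exists_PDA tfABx) => // B.
  by rewrite card_set_predC cardt card_exists_extends_by_sub.
- apply: (triforce_free_exists_PDA tfxBA) => // B.
  rewrite card_set_predC card_ord -[t + 1](eqP (valP B)); congr (_ - _).
  by apply: eq_card => x; rewrite inE exists_extends_by_sub.
(* The integers in column [A] sit in the [k - t] rows obtained by adding a point outside [A]. *)
- apply: (triforce_free_exists_PDA tfBAx) => // A.
  by rewrite card_set_predC cardt1 card_exists_extends_by_sup card_ord.
- apply: (triforce_free_exists_PDA tfxAB) => // A.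
  rewrite -[RHS](eqP (valP A)); apply: eq_card => x.
  by rewrite inE exists_extends_by_sup negbK.
Qed.
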